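(* Let $X \subset \mathbb{R}^{2n}$ be a centrally symmetric (about the origin) strictly convex body with $C^2$-smooth boundary, and let $T$ be its symplectic outer billiard map. Suppose that for every $x\in\partial X$ there exists a point $z\in\mathbb{R}^{2n}\setminus X$ with $T^4z=z$, $T^2z=-z$ (so the orbit $\{z,Tz,T^2z,T^3z\}$ is a centrally symmetric $4$-periodic orbit) and $x=(z+Tz)/2$. Then $X=\alpha X^\omega$ for some $\alpha>0$; consequently $\alpha^{-1/2}X$ is symplectically self-polar.
   Context: $\mathbb{R}^{2n}\cong\mathbb{C}^n$, $J$ is multiplication by $\sqrt{-1}$, $\omega(u,v)=\langle Ju,v\rangle$. For a convex body $X$ with origin in its interior, $X^\omega=\{y: \omega(x,y)\le 1\ \forall x\in X\}$; $X$ is symplectically self-polar if $X=X^\omega$. The characteristic line of $\partial X$ at $x$ is $\ker(\omega|_{T_x\partial X})$. Symplectic outer billiard map: for a strictly convex body $X$ with $C^1$ boundary and $z\in\mathbb{R}^{2n}\setminus X$, there is a unique $x\in\partial X$ such that the line through $z$ and $x$ is the characteristic line of $\partial X$ at $x$ and $\omega(x,x-z)>0$; then $T(z)=2x-z$. *)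

(* Defs.v *)
From HB Require Import structures.
From mathcomp Require Import all_boot all_order all_algebra.
From mathcomp Require Import all_classical all_reals all_analysis.
Set Implicit Arguments. Unset Strict Implicit. Unset Printing Implicit Defensive.
Import Order.TTheory GRing.Theory Num.Theory.
Import numFieldNormedType.Exports.
Local Open Scope classical_set_scope.
Local Open Scope ring_scope.

(* R^{2n} = C^n, points are row vectors (x_1..x_n, y_1..y_n), z_k = x_k + i y_k *)
Notation V R n := 'rV[R]_(n + n).

Section Defs.
Variables (R : realType) (n : nat).

Definition inner (u v : V R n) : R := \sum_(i < n + n) u 0 i * v 0 i.

(* J = multiplication by sqrt(-1): (x, y) |-> (-y, x) *)
Definition Jmul (u : V R n) : V R n := row_mx (- rsubmx u) (lsubmx u).

Definition omega (u v : V R n) : R := inner (Jmul u) v.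

Definition convex_body (X : set (V R n)) : Prop :=
  compact X /\ (interior X !=set0) /\
  (forall x y t, X x -> X y -> 0 <= t <= 1 -> X (t *: x + (1 - t) *: y)).

Definition strictly_convex (X : set (V R n)) : Prop :=
  forall x y t, X x -> X y -> x != y -> 0 < t < 1 ->
    interior X (t *: x + (1 - t) *: y).

Definition centrally_symmetric (X : set (V R n)) : Prop :=
  forall x, X x -> X (- x).

Definition boundary (X : set (V R n)) : set (V R n) :=
  closure X `\` interior X.

Definition ebasis (i : 'I_(n + n)) : V R n := delta_mx 0 i.

Definition C2 (f : V R n -> R) : Prop :=
  forall i j : 'I_(n + n),
    (forall x, derivable f x (ebasis i)) /\
    continuous ('D_(ebasis i) f) /\
    (forall x, derivable ('D_(ebasis i) f) x (ebasis j)) /\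
    continuous ('D_(ebasis j) ('D_(ebasis i) f)).

Definition C2_boundary (X : set (V R n)) : Prop :=
  forall p, boundary X p ->
    exists rho : V R n -> R, C2 rho /\
      (exists r : R, 0 < r /\
         forall y, ball p r y -> (X y <-> rho y <= 0)) /\
      (exists i, 'D_(ebasis i) rho p != 0).

Definition tangent_space (X : set (V R n)) (x : V R n) : set (V R n) :=
  [set v | exists gamma : R -> V R n,
     gamma 0 = x /\ (forall t, boundary X (gamma t)) /\
     derivable gamma 0 1 /\ 'D_1 gamma 0 = v].

Definition char_dir (X : set (V R n)) (x : V R n) : set (V R n) :=
  [set u | tangent_space X x u /\
           forall v, tangent_space X x v -> omega u v = 0].

(* x is the "foot" of the outer billiard at z: the line through z and x
   is the characteristic line x + char_dir X x, and omega(x, x - z) > 0 *)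
Definition billiard_foot (X : set (V R n)) (z x : V R n) : Prop :=
  boundary X x /\ char_dir X x (z - x) /\ 0 < omega x (x - z).

Definition outer_billiard (X : set (V R n)) (z : V R n) : V R n :=
  2 *: get [set x | billiard_foot X z x] - z.

Definition symp_polar (X : set (V R n)) : set (V R n) :=
  [set y | forall x, X x -> omega x y <= 1].

Definition scale_set (a : R) (X : set (V R n)) : set (V R n) :=
  [set a *: y | y in X].

End Defs.

(* Main.v *)
(** Writing [y := x - z], a centrally symmetric 4-periodic orbit through [x]
    says that [omega(., y)] is maximal on [X] at [x] and [omega(x, .)] is
    maximal on [X] at [y]: call [(x, y)] a conjugate pair, of value
    [c(x) = omega(x, y)].  If [c] is a constant [alpha], then the supporting
    half-spaces of [X] are the sets [omega(., y) <= alpha] with [y] in [X],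
    which is [X = alpha X^omega].

    For conjugate pairs [(x, y)] and [(x', y')] maximality gives
    [omega(x - x', y') <= c(x) - c(x') <= omega(x - x', y)], where both bounds
    are of second order in [x - x'].  Concretely, on a
    segment from [x0] to [x1] the gauge of [X] is a convex function with
    slope [m], and
    [c(s) - c(t) <= K (m(t) - m(s)) (t - s)]; summing over [N] equal steps
    bounds [c(0) - c(1)] by [K (m(1) - m(0)) / N], hence [c] is constant.
    Smoothness of the boundary only serves to show that the tangent space,
    defined by curves, contains a full hyperplane. *)

Require Import Defs.
From HB Require Import structures.
From mathcomp Require Import all_boot all_order all_algebra.
From mathcomp Require Import all_classical all_reals all_analysis.
From mathcomp Require Import ring lra.
Import Order.TTheory GRing.Theory Num.Theory.
Import numFieldNormedType.Exports.
Local Open Scope classical_set_scope.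
Local Open Scope ring_scope.

Set Implicit Arguments. Unset Strict Implicit. Unset Printing Implicit Defensive.

(** * First-order expansion from continuous partial derivatives *)

Section FirstOrderExpansion.
Variable R : realType.

Lemma is_derive_line (W : normedModType R) (f : W -> R) (q v : W) (t : R) :
  derivable f (q + t *: v) v ->
  is_derive t 1 (fun s => f (q + s *: v)) ('D_v f (q + t *: v)).
Proof.
move=> df.
have E : (fun h : R => h^-1 *: (((fun s => f (q + s *: v)) \o shift t) (h *: 1)
            - f (q + t *: v))) =
         (fun h : R => h^-1 *: ((f \o shift (q + t *: v)) (h *: v)
            - f (q + t *: v))).
  apply/funext => h /=; congr (_ *: (f _ - _)).
  by rewrite [h *: 1]mulr1 scalerDl addrCA.
by split; [rewrite /derivable E | rewrite /derive E].
Qed.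

Lemma MVT_line (W : normedModType R) (f : W -> R) (q v : W) (s : R) :
  (forall x, derivable f x v) ->
  exists2 t, `|t| <= `|s| & f (q + s *: v) - f q = s * 'D_v f (q + t *: v).
Proof.
move=> df; pose g t := f (q + t *: v).
have g' (t : R) : is_derive t 1 g ('D_v f (q + t *: v)) by exact: is_derive_line.
have cg (a b : R) : {within `[a, b], continuous g}.
  by apply: derivable_within_continuous => t _; case: (g' t).
have g0 : g 0 = f q by rewrite /g scale0r addr0.
have [s0|s0] := leP 0 s.
- have [//|t] := MVT_segment s0 (fun t _ => g' t).
  rewrite in_itv/= => /andP[t0 ts] E; exists t; first by rewrite !ger0_norm.
  by rewrite -g0 -/(g s) E subr0 mulrC.
- have [//|t] := MVT_segment (ltW s0) (fun t _ => g' t).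
  rewrite in_itv/= => /andP[st t0] E; exists t.
    by rewrite !ler0_norm ?lerN2 ?(ltW s0).
  by rewrite -g0 -/(g s) -opprB E sub0r mulrN opprK mulrC.
Qed.

Lemma ler_norm_coord (m : nat) (x : 'rV[R]_m) (i : 'I_m) : `|x 0 i| <= `|x|.
Proof. by rewrite /Num.norm/= mx_normrE; exact: (le_bigmax _ _ (0, i)). Qed.

Lemma norm_rV_le (m : nat) (x : 'rV[R]_m) (c : R) :
  0 <= c -> (forall i, `|x 0 i| <= c) -> `|x| <= c.
Proof.
move=> c0 H; rewrite /Num.norm/= mx_normrE.
by apply/bigmax_leP; split=> // -[i j] _ /=; rewrite ord1.
Qed.

(** Coordinates are switched on one at a time through the truncations [T k] of [h]. By the mean
    value theorem each increment involves a partial derivative at a point within [|h|] of [p], hence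
    [e]-close to its value at [p]. *)
Lemma continuous_partials_expansion (m : nat) (f : 'rV[R]_m -> R) (p : 'rV[R]_m) :
  (forall i x, derivable f x (delta_mx 0 i)) ->
  (forall i, {for p, continuous ('D_(delta_mx 0 i) f)}) ->
  forall eps, 0 < eps -> \forall h \near (0 : 'rV[R]_m),
    `|f (p + h) - f p - \sum_i 'D_(delta_mx 0 i) f p * h 0 i| <= eps * `|h|.
Proof.
move=> df cf eps eps0.
pose a i := 'D_(delta_mx 0 i) f p.
pose L (h : 'rV[R]_m) := \sum_i a i * h 0 i.
have LD u (c : R) i : L (u + c *: delta_mx 0 i) = L u + c * a i.
  rewrite /L.
  under eq_bigr do rewrite !mxE mulrDr.
  rewrite big_split/=; congr (_ + _).
  rewrite (bigD1 i)//= !eqxx/= mulr1 mulrC big1 ?addr0// => j ji.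
  by rewrite (negPf ji) !mulr0.
have m0 : 0 < m.+1%:R :> R by rewrite ltr0n.
(* Each of the [m] steps costs at most [e * |h|]; [m + 1] keeps the divisor nonzero for [m = 0]. *)
pose e := eps / m.+1%:R.
have e0 : 0 < e by rewrite divr_gt0.
have : \forall h \near (0 : 'rV[R]_m), forall i,
    `|a i - 'D_(delta_mx 0 i) f (p + h)| <= e.
  apply: (@filter_forall _ 'I_m (fun i (h : 'rV[R]_m) =>
    `|a i - 'D_(delta_mx 0 i) f (p + h)| <= e) _ (nbhs_filter (0 : 'rV[R]_m))) => i.
  have /cvgrPdist_le/(_ _ e0)/nbhs_ballP[d d0 Hd] := cf i.
  apply/nbhs_ballP; exists d => // h.
  rewrite -ball_normE/= sub0r normrN => hd; apply: Hd.
  by rewrite -ball_normE/= opprD addNKr normrN.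
move=> /nbhs_ballP[d d0 Hd]; apply/nbhs_ballP; exists d => // h.
rewrite -ball_normE/= sub0r normrN => hd.
pose T k : 'rV[R]_m := \row_i (if (i < k)%N then h 0 i else 0).
have step k : (k <= m)%N ->
    `|f (p + T k) - f p - L (T k)| <= k%:R * (e * `|h|).
  elim: k => [_|k IH km].
    have -> : T 0%N = 0 by apply/rowP => i; rewrite !mxE.
    rewrite addr0 subrr sub0r normrN mul0r /L big1 ?normr0// => i _.
    by rewrite mxE mulr0.
  pose i := Ordinal km.
  have ET : T k.+1 = T k + h 0 i *: delta_mx 0 i.
    apply/rowP => j; rewrite !mxE eqxx/= ltnS leq_eqVlt.
    have [->|ji] := eqVneq j i; first by rewrite eqxx ltnn/= mulr1 add0r.
    have -> : (nat_of_ord j == k) = false by apply/eqP => jk; case/eqP: ji; apply/val_inj.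
    by rewrite mulr0 addr0.
  have [t th E] := @MVT_line _ f (p + T k) (delta_mx 0 i) (h 0 i) (df i).
  rewrite ET LD addrA.
  have -> : f (p + T k + h 0 i *: delta_mx 0 i) - f p - (L (T k) + h 0 i * a i) =
      (f (p + T k) - f p - L (T k)) -
      h 0 i * (a i - 'D_(delta_mx 0 i) f (p + T k + t *: delta_mx 0 i)).
    rewrite mulrBr -E; ring.
  rewrite -natr1 mulrDl mul1r; apply: (le_trans (ler_normB _ _)).
  apply: lerD; first exact: IH (ltnW km).
  rewrite normrM mulrC; apply: ler_pM => //; last exact: ler_norm_coord.
  rewrite -addrA; apply: Hd; rewrite -ball_normE/= sub0r normrN.
  apply: le_lt_trans hd; apply: norm_rV_le => // j; rewrite !mxE eqxx/=.
  have [->|ji] := eqVneq j i.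
    by rewrite ltnn mulr1 add0r (le_trans th) ?ler_norm_coord.
  rewrite mulr0 addr0; case: ifP => _; first exact: ler_norm_coord.
  by rewrite normr0.
have ET : T m = h by apply/rowP => i; rewrite mxE ltn_ord.
have := step m (leqnn m); rewrite ET => /le_trans; apply.
rewrite mulrA ler_wpM2r// /e mulrCA ler_piMr ?(ltW eps0)//.
by rewrite ler_pdivrMr// mul1r ler_nat.
Qed.

End FirstOrderExpansion.

(** * Symmetric convex bodies and their boundary along rays *)

Section ConvexBodies.
Variables (R : realType) (n : nat) (X : set (V R n)).

Lemma near_zero_scale (W : normedModType R) (P : set W) (v : W) :
  nbhs 0 P -> exists2 s : R, 0 < s & forall t, `|t| <= s -> P (t *: v).
Proof.
move=> /nbhs_ballP[r /= r0 Pr].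
have v1 : 0 < `|v| + 1 by rewrite ltr_wpDl.
exists (r / 2 / (`|v| + 1)); first by rewrite !divr_gt0.
move=> t; rewrite ler_pdivlMr// => tr; apply: Pr.
rewrite -ball_normE/= sub0r normrN normrZ.
have : `|t| * `|v| <= `|t| * (`|v| + 1) by rewrite ler_wpM2l// lerDl.
lra.
Qed.

Lemma interior_scale_add (W : normedModType R) (A : set W) (x v : W) :
  interior A x -> exists2 s : R, 0 < s & forall t, `|t| <= s -> A (x + t *: v).
Proof.
move=> /nbhs_ballP[r r0 Ar]; apply: (@near_zero_scale W (fun h => A (x + h)) v).
apply/nbhs_ballP; exists r => // h; rewrite -ball_normE/= sub0r normrN => hr.
by apply: Ar; rewrite -ball_normE/= opprD addNKr normrN.
Qed.

Hypothesis bX : convex_body X.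

Lemma convex_body_norm_bounded : exists2 M : R, 0 < M & forall x, X x -> `|x| <= M.
Proof.
have [M [_ HM]] := compact_bounded bX.1.
exists (`|M| + 1); first by rewrite ltr_wpDl.
by apply: HM; rewrite (le_lt_trans (ler_norm M))// ltrDl.
Qed.

Lemma convex_body_closure : closure X = X.
Proof.
apply/esym/closure_id; apply: compact_closed bX.1.
exact: (@norm_hausdorff _ (V R n)).
Qed.

Lemma boundary_sub (x : V R n) : boundary X x -> X x.
Proof. by move=> []; rewrite convex_body_closure. Qed.

Hypothesis sX : centrally_symmetric X.

(** For [a] interior and [h] small, [h] is the midpoint of [a + 2 *: h] and [- a], both in [X]. *)
Lemma convex_body_interior0 : interior X 0.
Proof.
have [a /nbhs_ballP[r /= r0 Xr]] := bX.2.1.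
apply/nbhs_ballP; exists (r / 2); first by rewrite /= divr_gt0.
move=> h; rewrite -ball_normE/= sub0r normrN => hr.
have Xa : X a by apply: Xr; exact: ballxx.
have Xh : X (a + 2 *: h).
  apply: Xr; rewrite -ball_normE/= opprD addNKr normrN normrZ ger0_norm//.
  by rewrite mulrC -ltr_pdivlMr.
have := bX.2.2 _ _ 2^-1 Xh (sX Xa).
have -> : 2^-1 *: (a + 2 *: h) + (1 - 2^-1) *: - a = h.
  rewrite scalerDr scalerA mulVf ?pnatr_eq0// scale1r.
  have -> : 1 - 2^-1 = 2^-1 :> R by lra.
  by rewrite scalerN addrAC subrr add0r.
by apply; lra.
Qed.

Let X0 : X 0. Proof. exact: interior_subset convex_body_interior0. Qed.

Lemma boundary_neq0 (x : V R n) : boundary X x -> x != 0.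
Proof. by move=> [_ Ix]; apply/eqP => x0; apply: Ix; rewrite x0; exact: convex_body_interior0. Qed.

(** The factor is the supremum of the [t] with [t *: v] in [X]: it is approached from within [X],
    and an interior point there would allow a larger [t]. *)
Lemma ray_meets_boundary (v : V R n) : v != 0 -> exists2 l, 0 < l & boundary X (l *: v).
Proof.
move=> v0; have nv : 0 < `|v| by rewrite normr_gt0.
pose E := [set t : R | X (t *: v)].
have [M M0 HM] := convex_body_norm_bounded.
have ubE : ubound E (M / `|v|).
  move=> t /HM; rewrite normrZ ler_pdivlMr// => /(le_trans _); apply.
  by rewrite ler_wpM2r// ler_norm.
have hE : has_sup E.
  by split; [exists 0; rewrite /E/= scale0r | exists (M / `|v|)].
have [s s0 Hs] := interior_scale_add v convex_body_interior0.
have Es : E s by rewrite /E/= -[_ *: _]add0r; apply: Hs; rewrite ger0_norm ?(ltW s0).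
have supE t : E t -> t <= sup E by move=> Et; apply: ub_le_sup => //; exact: hE.2.
exists (sup E); first exact: lt_le_trans (supE _ Es).
split.
  move=> B /nbhs_ballP[e /= e0 Be].
  have [t Et tE] := sup_adherent (divr_gt0 e0 nv) hE.
  exists (t *: v); split => //; apply: Be; rewrite -ball_normE/= -scalerBl normrZ.
  by rewrite -ltr_pdivlMr// ger0_norm ?subr_ge0 ?supE// ltrBlDr -ltrBlDl.
move=> /interior_scale_add-/(_ v)[e e0 /(_ e)].
rewrite ger0_norm ?(ltW e0)// -scalerDl => /(_ (lexx _))/supE.
by rewrite gerDl leNgt e0.
Qed.

Hypothesis scX : strictly_convex X.

(** Strict convexity applies to the segment from [x] to the interior point 0. *)
Lemma shrink_not_boundary (t : R) (x : V R n) : X x -> 0 < t < 1 -> ~ boundary X (t *: x).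
Proof.
move=> Xx t01 B; case: (B) => _; apply.
rewrite -[_ *: _]addr0 -[0](scaler0 _ (1 - t)); apply: scX => //.
by apply: contra_neq (boundary_neq0 B) => ->; rewrite scaler0.
Qed.

Lemma boundary_ray_ge1 (l : R) (x : V R n) : X x -> 0 < l -> boundary X (l *: x) -> 1 <= l.
Proof.
move=> Xx l0 B; rewrite leNgt; apply/negP => l1.
by apply: (shrink_not_boundary (t := l) Xx) => //; rewrite l0.
Qed.

Lemma boundary_ray_uniq (l : R) (x : V R n) : 0 < l -> boundary X x -> boundary X (l *: x) -> l = 1.
Proof.
move=> l0 Bx B; apply/eqP; rewrite eq_le (boundary_ray_ge1 (boundary_sub Bx) l0 B) andbT.
rewrite -(invr_ge1 (x := l)) ?inE ?unitfE ?gt_eqF//.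
have B' : boundary X (l^-1 *: (l *: x)) by rewrite scalerK ?gt_eqF.
by apply: (boundary_ray_ge1 (boundary_sub B)) B'; rewrite invr_gt0.
Qed.

End ConvexBodies.

(** * Bilinearity, antisymmetry and boundedness of [omega] *)

Section SymplecticForm.
Variables (R : realType) (n : nat).
Implicit Types (u v w : V R n) (c : R).

Lemma innerDr u v w : inner u (v + w) = inner u v + inner u w.
Proof.
by rewrite /inner -big_split; apply: eq_bigr => i _; rewrite mxE mulrDr.
Qed.

Lemma innerZr u c v : inner u (c *: v) = c * inner u v.
Proof.
by rewrite /inner mulr_sumr; apply: eq_bigr => i _; rewrite mxE mulrCA.
Qed.

Lemma omegaDr u v w : omega u (v + w) = omega u v + omega u w.
Proof. exact: innerDr. Qed.

Lemma omegaZr u c v : omega u (c *: v) = c * omega u v.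
Proof. exact: innerZr. Qed.

Lemma omegaNr u v : omega u (- v) = - omega u v.
Proof. by rewrite -scaleN1r omegaZr mulN1r. Qed.

Lemma omegaC u v : omega u v = - omega v u.
Proof.
rewrite /omega /inner /Jmul !big_split_ord/= opprD addrC -!sumrN.
congr (_ + _); apply: eq_bigr => i _;
  by rewrite ?row_mxEl ?row_mxEr !mxE; ring.
Qed.

Lemma omegaDl u v w : omega (u + v) w = omega u w + omega v w.
Proof. by rewrite omegaC omegaDr opprD -!omegaC. Qed.

Lemma omegaZl c u v : omega (c *: u) v = c * omega u v.
Proof. by rewrite omegaC omegaZr -mulrN -omegaC. Qed.

Lemma omegaNl u v : omega (- u) v = - omega u v.
Proof. by rewrite -scaleN1r omegaZl mulN1r. Qed.

Lemma omega0r u : omega u 0 = 0.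
Proof. by rewrite -(scale0r (0 : V R n)) omegaZr mul0r. Qed.

Lemma omega_bounded (M : R) u v : 0 <= M -> `|u| <= M -> `|v| <= M ->
  `|omega u v| <= M * M *+ (n + n).
Proof.
move=> M0 uM vM; rewrite /omega /inner -[X in _ *+ X]card_ord -sumr_const.
apply: (le_trans (ler_norm_sum _ _ _)); apply: ler_sum => i _.
rewrite normrM ler_pM//; last exact: le_trans (ler_norm_coord _ _) vM.
rewrite /Jmul; case: (split_ordP i) => j ->; rewrite ?row_mxEl ?row_mxEr !mxE.
  by rewrite normrN (le_trans (ler_norm_coord _ _)).
exact: le_trans (ler_norm_coord _ _) uM.
Qed.

End SymplecticForm.

(** * Supporting hyperplane at a boundary point *)

Section TangentHyperplane.
Variables (R : realType) (n : nat) (X : set (V R n)).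
Hypotheses (bX : convex_body X) (sX : centrally_symmetric X).
Hypotheses (scX : strictly_convex X) (C2X : C2_boundary X).

Lemma ge0_of_small_affine (s A B : R) :
  0 < s -> (forall t, 0 < t <= s -> 0 <= A + t * B) -> 0 <= A.
Proof.
move=> s0 H; rewrite leNgt; apply/negP => A0.
have B1 : 0 < `|B| + 1 by rewrite ltr_wpDl.
(* This [t] gives [t * |B| <= - A / 2], so that [A + t * B] would be negative. *)
pose t := Num.min s (- A / 2 / (`|B| + 1)).
have tA : t * (`|B| + 1) <= - A / 2 by rewrite -ler_pdivlMr// ge_min lexx orbT.
have t0 : 0 < t by rewrite lt_min s0 !divr_gt0// oppr_gt0.
have /H : 0 < t <= s by rewrite t0 ge_min lexx.
have : t * B <= t * `|B| by rewrite ler_pM2l// ler_norm.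
lra.
Qed.

(** The normal [a] is the gradient of the local defining function [rho]; the expansion at [p] shows
    that the sign of [inner a w] decides the sign of [rho] at [p + t *: w] for small [t > 0]. *)
Lemma boundary_normal_local (p : V R n) : boundary X p ->
  exists a : V R n, [/\ a != 0,
    forall w, inner a w < 0 ->
      exists2 s, 0 < s & forall t, 0 <= t <= s -> X (p + t *: w) &
    forall w, 0 < inner a w ->
      exists2 s, 0 < s & forall t, 0 < t <= s -> ~ X (p + t *: w)].
Proof.
move=> Bp; have [rho [C2r [[r [r0 Hr]] [i0 Di0]]]] := C2X Bp.
pose a : V R n := \row_i 'D_(ebasis R i) rho p.
have E eps w : 0 < eps -> exists2 s : R, 0 < s & forall t, `|t| <= s ->
    ball p r (p + t *: w) /\
    `|rho (p + t *: w) - rho p - t * inner a w| <= eps * `|t|.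
  move=> eps0; have w1 : 0 < `|w| + 1 by rewrite ltr_wpDl.
  have := @continuous_partials_expansion R _ rho p
    (fun i => (C2r i i).1) (fun i => (C2r i i).2.1 p) _ (divr_gt0 eps0 w1).
  move=> /(near_zero_scale w)[s1 s10 H1].
  have [s2 s20 H2] : exists2 s : R, 0 < s & forall t, `|t| <= s -> ball p r (p + t *: w).
    by apply: interior_scale_add; exact: nbhsx_ballx.
  exists (Num.min s1 s2); first by rewrite lt_min s10.
  move=> t; rewrite le_min => /andP[t1 t2]; split; first exact: H2.
  have := H1 _ t1; rewrite -innerZr.
  have -> : \sum_i 'D_(delta_mx 0 i) rho p * (t *: w) 0 i = inner a (t *: w).
    by rewrite /inner; apply: eq_bigr => i _; rewrite [a _ _]mxE.
  move=> /le_trans; apply; rewrite normrZ mulrAC ler_pdivrMr// -!mulrA.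
  by rewrite ler_pM2l// ler_wpM2l// lerDl.
have rp_le0 : rho p <= 0 by apply/Hr; [exact: ballxx | exact: boundary_sub].
(* The points [(1 + t) *: p] lie outside [X] by strict convexity, so [rho] is positive there; then
   [t] tends to 0. *)
have rp_ge0 : 0 <= rho p.
  have [s s0 Hs] := E 1 p ltr01.
  apply: (@ge0_of_small_affine s _ (inner a p + 1)) => // t /andP[t0 ts].
  have [|bt] := Hs t; first by rewrite ger0_norm ?(ltW t0).
  have nX : ~ X (p + t *: p).
    rewrite -[X in X + _]scale1r -scalerDl => Xt.
    have t1 : 0 < 1 + t by lra.
    apply: (shrink_not_boundary bX sX scX (t := (1 + t)^-1) Xt).
      by rewrite invr_gt0 t1 invf_lt1// ltrDl.
    by rewrite scalerK ?gt_eqF.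
  have : 0 < rho (p + t *: p) by rewrite ltNge; apply/negP => /Hr-/(_ bt).
  move=> rt; rewrite (ger0_norm (ltW t0)) => /ler_normlP[]; lra.
have rp0 : rho p = 0 by lra.
exists a; split.
- by apply: contra_neq Di0 => /rowP/(_ i0); rewrite !mxE.
(* An error equal to the linear term still gives [rho <= 0]; the strict inequality of the next case
   needs half of it. *)
- move=> w aw; have [|s s0 Hs] := E (- inner a w) w; first by rewrite oppr_gt0.
  exists s => // t /andP[t0 ts]; have [|bt] := Hs t; first by rewrite ger0_norm.
  by rewrite (ger0_norm t0) rp0 => /ler_normlP[] *; apply/(Hr _ bt); lra.
- move=> w aw; have [|s s0 Hs] := E (inner a w / 2) w; first by rewrite divr_gt0.
  exists s => // t /andP[t0 ts]; have [|bt] := Hs t; first by rewrite ger0_norm ?(ltW t0).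
  rewrite (ger0_norm (ltW t0)) rp0 => /ler_normlP[H1 H2] /(Hr _ bt).
  have : 0 < t * inner a w by rewrite mulr_gt0.
  lra.
Qed.

(** Convexity makes the local normal a global support: if [v] in [X] lay beyond the hyperplane, the
    segment from [p] to [v] would stay in [X] yet leave it at once. A small positive multiple of [a]
    lies in [X], whence [0 < inner a p]. *)
Lemma boundary_normal (p : V R n) : boundary X p ->
  exists a : V R n, [/\ 0 < inner a p,
    forall v, X v -> inner a v <= inner a p &
    forall w, inner a w < 0 ->
      exists2 s, 0 < s & forall t, 0 <= t <= s -> X (p + t *: w)].
Proof.
move=> Bp; have Xp := boundary_sub bX Bp.
have [a [a0 Hin Hout]] := boundary_normal_local Bp.
have supp v : X v -> inner a v <= inner a p.
  move=> Xv; rewrite leNgt; apply/negP => va.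
  have [|s s0 Hs] := Hout (v - p).
    by rewrite -scaleN1r innerDr innerZr mulN1r subr_gt0.
  pose t := Num.min s 1; have t0 : 0 < t by rewrite lt_min s0 ltr01.
  have t1 : t <= 1 by rewrite ge_min lexx orbT.
  apply: (Hs t); first by rewrite t0 ge_min lexx.
  have -> : p + t *: (v - p) = t *: v + (1 - t) *: p.
    by rewrite scalerBr scalerBl scale1r addrCA.
  by apply: bX.2.2 => //; rewrite t1 ltW.
exists a; split => //.
have [s s0 Hs] := interior_scale_add a (convex_body_interior0 bX sX).
have Xsa : X (s *: a) by rewrite -[_ *: _]add0r; apply: Hs; rewrite ger0_norm ?(ltW s0).
apply: lt_le_trans (supp _ Xsa); rewrite innerZr mulr_gt0//.
rewrite /inner lt_def sumr_ge0 ?andbT; last by move=> i _; rewrite -expr2 sqr_ge0.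
apply: contra_neq a0 => /psumr_eq0P a0; apply/rowP => i.
by apply/eqP; rewrite mxE -sqrf_eq0 expr2 a0// => j _; rewrite -expr2 sqr_ge0.
Qed.

End TangentHyperplane.

(** * Tangent vectors from curves, and support functionals *)

Section CharacteristicLine.
Variables (R : realType) (n : nat) (X : set (V R n)).
Hypotheses (bX : convex_body X) (sX : centrally_symmetric X).
Hypotheses (scX : strictly_convex X) (C2X : C2_boundary X).

(* The curve is the radial projection of [p + t v] to the boundary, with
   factor [1 - o(t)] because [v] is tangent. *)
Lemma tangent_space_kernel (p a v : V R n) : boundary X p -> 0 < inner a p ->
  (forall w, X w -> inner a w <= inner a p) ->
  (forall w, inner a w < 0 ->
      exists2 s, 0 < s & forall t, 0 <= t <= s -> X (p + t *: w)) ->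
  inner a v = 0 -> tangent_space X p v.
Proof.
move=> Bp ap supp Hin av.
have apv t : inner a (p + t *: v) = inner a p by rewrite innerDr innerZr av mulr0 addr0.
have /choice[l Hl] t : exists l, 0 < l /\ boundary X (l *: (p + t *: v)).
  have [|l l0 Bl] := ray_meets_boundary bX sX (v := p + t *: v); last by exists l.
  apply: contraTneq ap => /(congr1 (inner a)); rewrite apv => ->.
  by rewrite -(scale0r (0 : V R n)) innerZr mul0r ltxx.
have l1 t : l t <= 1.
  have [l0 /(boundary_sub bX)/supp] := Hl t.
  by rewrite innerZr apv ger_pMl.
have l0E : l 0 = 1.
  have [l0] := Hl 0; rewrite scale0r addr0; exact: boundary_ray_uniq l0 Bp.
(* Since [w - eps *: p] points strictly inwards, a short step along it stays in [X]; the rescaled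
   point is such a step. *)
have half (eps : R) (w : V R n) : 0 < eps -> inner a w = 0 ->
    exists2 s, 0 < s & forall t, 0 <= t <= s -> X ((1 + eps * t)^-1 *: (p + t *: w)).
  move=> eps0 aw; have [|s s0 Hs] := Hin (w - eps *: p).
    by rewrite -scaleNr innerDr innerZr aw add0r mulNr oppr_lt0 mulr_gt0.
  exists s => // t /andP[t0 ts].
  have d1 : 1 <= 1 + eps * t by rewrite lerDl mulr_ge0 ?(ltW eps0).
  have d0 : 0 < 1 + eps * t by lra.
  have -> : (1 + eps * t)^-1 *: (p + t *: w) =
      p + (t / (1 + eps * t)) *: (w - eps *: p).
    set k := (1 + eps * t)^-1.
    have kE : k = 1 - t * k * eps by rewrite /k; field; rewrite gt_eqF.
    rewrite scalerDr {1}kE scalerBl scale1r scalerBr !scalerA [k * t]mulrC.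
    by rewrite addrAC -addrA.
  apply: Hs; rewrite divr_ge0 ?(ltW d0)//= ler_pdivrMr//.
  by apply: (le_trans ts); rewrite ler_peMr ?(ltW s0).
(* A point of [X] on the ray bounds [l t] below by [1 / (1 + eps * |t|)]; the directions [v] and
   [- v] serve the two signs of [t]. *)
have lower (eps : R) : 0 < eps ->
    exists2 s, 0 < s & forall t, `|t| <= s -> 1 - l t <= eps * `|t|.
  move=> eps0; have [s1 s10 H1] := half eps v eps0 av.
  have [|s2 s20 H2] := half eps (- v) eps0.
    by rewrite -scaleN1r innerZr av mulr0.
  exists (Num.min s1 s2); first by rewrite lt_min s10.
  move=> t; rewrite le_min => /andP[t1 t2].
  have Xt : X ((1 + eps * `|t|)^-1 *: (p + t *: v)).
    have [t0|t0] := leP 0 t.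
      by rewrite ger0_norm//; apply: H1; rewrite t0/= -[t]ger0_norm.
    have -> : t *: v = `|t| *: - v by rewrite ltr0_norm// scalerN scaleNr opprK.
    by apply: H2; rewrite normr_ge0.
  have [lt0 Bl] := Hl t.
  have d1 : 1 <= 1 + eps * `|t| by rewrite lerDl mulr_ge0 ?(ltW eps0).
  have d0 : 0 < 1 + eps * `|t| by lra.
  have : 1 <= l t * (1 + eps * `|t|).
    apply: (boundary_ray_ge1 bX sX scX Xt); first exact: mulr_gt0.
    by rewrite -scalerA scalerKV ?gt_eqF.
  have := l1 t; have : 0 <= eps * `|t| by rewrite mulr_ge0 ?(ltW eps0).
  nra.
pose gamma t := l t *: (p + t *: v).
have g0 : gamma 0 = p by rewrite /gamma l0E scale0r addr0 scale1r.
have cg : h^-1 *: ((gamma \o shift 0) (h *: 1) - gamma 0) @[h --> (0 : R)^'] --> v.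
  apply/cvgrPdist_le => eps eps0.
  (* The difference quotient misses [v] by [(1 - l h) / h] times [p + h *: v], whose norm is at most
     [|p| + |v|] once [|h| < 1]. *)
  have c0 : 0 < `|p| + `|v| + 1 by rewrite ltr_wpDl ?addr_ge0.
  have [s s0 Hs] := lower _ (divr_gt0 eps0 c0).
  apply/nbhs_ballP; exists (Num.min s 1); first by rewrite /= lt_min s0 ltr01.
  move=> h; rewrite -ball_normE/= sub0r normrN lt_min => /andP[hs h1] h0.
  rewrite g0 addr0 [h *: 1]mulr1 /gamma.
  have -> : v - h^-1 *: (l h *: (p + h *: v) - p) = (h^-1 * (1 - l h)) *: (p + h *: v).
    rewrite -scalerA scalerBl scale1r -[X in X - _](scalerK h0) -scalerBr.
    by congr (_ *: _); rewrite opprB addrA [h *: v + p]addrC.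
  have hn : 0 < `|h| by rewrite normr_gt0.
  rewrite normrZ normrM normfV [`|1 - _|]ger0_norm ?subr_ge0//.
  apply: (@le_trans _ _ (eps / (`|p| + `|v| + 1) * (`|p| + `|v|))).
    apply: ler_pM => //; first by rewrite mulr_ge0 ?invr_ge0 ?subr_ge0.
      by rewrite mulrC ler_pdivrMr//; apply: Hs; exact: ltW.
    apply: (le_trans (ler_normD _ _)); rewrite lerD2l normrZ.
    by rewrite ler_piMl// ltW.
  by rewrite mulrAC ler_pdivrMr// ler_pM2l// lerDl.
exists gamma; split => //; split; first by move=> t; exact: (Hl t).2.
split; first by apply/cvg_ex; exists v.
exact: cvg_lim cg.
Qed.

(** The tangent space contains the kernel of [inner a], so [f] is a multiple of [inner a], positive
    because [f p > 0]; it inherits the support property. *)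
Lemma support_of_tangent_annihilator (f : V R n -> R) (p : V R n) :
  boundary X p ->
  (forall u v, f (u + v) = f u + f v) -> (forall c v, f (c *: v) = c * f v) ->
  (forall v, tangent_space X p v -> f v = 0) -> 0 < f p ->
  forall v, X v -> f v <= f p.
Proof.
move=> Bp fD fZ fT fp v Xv.
have [a [ap supp Hin]] := boundary_normal bX sX scX C2X Bp.
have ap0 : inner a p != 0 by rewrite gt_eqF.
have /fT : tangent_space X p (v + (- (inner a v / inner a p)) *: p).
  apply: (tangent_space_kernel Bp ap supp Hin).
  by rewrite innerDr innerZr mulNr divfK// subrr.
rewrite fD fZ mulNr => /eqP; rewrite subr_eq0 => /eqP ->.
by rewrite ger_pMl// ler_pdivrMr// mul1r supp.
Qed.

End CharacteristicLine.

(** * Constancy of the value of conjugate pairs *)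

Section ConjugatePairs.
Variables (R : realType) (n : nat) (X : set (V R n)).

Definition conjugate_pair (x y : V R n) : Prop :=
  [/\ X x, X y, 0 < omega x y, forall v, X v -> omega v y <= omega x y &
      forall v, X v -> omega x v <= omega x y].

(* Summing over [N] equal steps, the right-hand side telescopes to [O(1/N)]. *)
Lemma le_of_monotone_modulus (c m : R -> R) (K : R) :
  (forall s t, 0 <= s <= t -> t <= 1 -> c s - c t <= K * ((m t - m s) * (t - s))) ->
  c 0 <= c 1.
Proof.
move=> H; rewrite -subr_le0 leNgt; apply/negP => A0.
set A := c 0 - c 1 in A0; pose B := K * (m 1 - m 0).
(* Chosen so that [B < N * A], against the telescoped bound [A <= B / N]. *)
pose N := (Num.truncn (B / A)).+1.
have N0 : 0 < N%:R :> R by rewrite ltr0n.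
have BN : B < N%:R * A by rewrite -ltr_pdivrMr// truncnS_gt.
have step k : (k <= N)%N ->
    c 0 - c (k%:R / N%:R) <= K * (m (k%:R / N%:R) - m 0) / N%:R.
  elim: k => [_|k IH kN]; first by rewrite mul0r !subrr mulr0 mul0r.
  have := H (k%:R / N%:R) (k.+1%:R / N%:R).
  rewrite divr_ge0 ?ler0n//= ler_pM2r ?invr_gt0// ler_nat leqnSn.
  rewrite ler_pdivrMr// mul1r ler_nat kN -mulrBl -natr1 addrAC subrr add0r => /(_ erefl erefl).
  by have := IH (ltnW kN); lra.
have := step N (leqnn N); rewrite divff ?gt_eqF// ler_pdivlMr// -/A -/B.
lra.
Qed.

Lemma conjugate_pair_oppL x y v : centrally_symmetric X -> conjugate_pair x y ->
  X v -> - omega x y <= omega v y.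
Proof. by move=> sX [_ _ _ H _] /sX/H; rewrite omegaNl lerNl. Qed.

(** Maximality in the first argument, used for both pairs, forces [l = 1]; maximality in the second
    then equates the values. Thus the value does not depend on the choice of conjugate. *)
Lemma conjugate_pair_ray l x y y' : 0 < l ->
  conjugate_pair (l *: x) y -> conjugate_pair x y' -> omega (l *: x) y = omega x y'.
Proof.
move=> l0 [Xlx Xy c0 H1 H2] [Xx Xy' c0' H1' H2'].
have l1 : l = 1.
  apply/eqP; rewrite eq_le; apply/andP; split.
    by have := H1' _ Xlx; rewrite omegaZl ger_pMl.
  by move: c0 (H1 _ Xx); rewrite omegaZl pmulr_rgt0// => w0; rewrite ler_pMl.
move: (H2 _ Xy') (H2' _ Xy); rewrite l1 scale1r => ? ?.
by apply/eqP; rewrite eq_le; apply/andP.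
Qed.

Hypotheses (bX : convex_body X) (sX : centrally_symmetric X).
Hypothesis conjX : forall x, boundary X x -> exists y, conjugate_pair x y.

(* Along the segment from [x0] to [x1], with [l t] the factor projecting [x t]
   to the boundary and [y t] its conjugate, convexity of [1 / l] bounds the
   increments of [omega (l t *: x t) (y t)] by those of its slope [m]. *)
Lemma conjugate_pair_le (x0 y0 x1 y1 : V R n) :
  conjugate_pair x0 y0 -> conjugate_pair x1 y1 -> omega x0 y0 <= omega x1 y1.
Proof.
(* For antipodal points the segment meets the origin; there [- y0] is tested against [y1]
   directly. *)
move=> P0 P1; have [x01|x01] := eqVneq x0 (- x1).
  case: P0 P1 => [_ Xy0 _ _ _] [_ _ _ _ /(_ _ (sX Xy0))].
  by rewrite x01 omegaNl omegaNr.
pose d := x1 - x0; pose x (t : R) := x0 + t *: d.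
have x0E : x 0 = x0 by rewrite /x scale0r addr0.
have x1E : x 1 = x1 by rewrite /x scale1r addrC subrK.
have xst s t : x t = x s + (t - s) *: d.
  by rewrite /x -addrA -scalerDl [s + _]addrC subrK.
have xne0 t : 0 <= t <= 1 -> x t != 0.
  move=> t01; apply: contra_neq x01 => xt0.
  have E y : (1 - t) * omega x0 y + t * omega x1 y = 0.
    have := congr1 (fun w => omega w y) xt0.
    rewrite /= /x /d omegaDl omegaZl omegaDl omegaNl (_ : omega 0 y = 0); last first.
      by rewrite omegaC omega0r oppr0.
    lra.
  (* In [E y0] the bound [omega x1 y0 >= - omega x0 y0] gives [t >= 1/2]; symmetrically [E y1] gives
     [t <= 1/2]. *)
  have t2 : t = 2^-1.
    have := conjugate_pair_oppL sX P1 (let: And5 a _ _ _ _ := P0 in a).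
    have := conjugate_pair_oppL sX P0 (let: And5 a _ _ _ _ := P1 in a).
    case: P0 => _ _ c0 _ _; case: P1 => _ _ c1 _ _.
    have := E y0; have := E y1; nra.
  move: xt0; rewrite /x /d t2 => /(congr1 ( *:%R 2)).
  rewrite scaler0 scalerDr scalerA divff ?pnatr_eq0// scale1r addrCA scalerDl scale1r.
  by rewrite addrC addrK => /eqP; rewrite addr_eq0 => /eqP ->.
have [M M0 HM] := convex_body_norm_bounded bX.
have [del del0 Hdel] : exists2 del, 0 < del & forall t, 0 <= t <= 1 -> del <= `|x t|.
  have cx : continuous (fun t : R => `|x t|).
    move=> t; apply: continuous_comp; last exact: norm_continuous.
    by apply: cvgD; [exact: cvg_cst | apply: cvgZr_tmp; exact: cvg_id].
  have [t0] := EVT_min (@ler01 R) (continuous_subspaceT cx).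
  rewrite in_itv/= => t001 Ht0; exists `|x t0|; first by rewrite normr_gt0 xne0.
  by move=> t t01; apply: Ht0; rewrite in_itv.
have /choice[ly Hly] t : exists ly : R * V R n, 0 <= t <= 1 ->
    0 < ly.1 /\ conjugate_pair (ly.1 *: x t) ly.2.
  have [t01|] := boolP (0 <= t <= 1); last by move=> _; exists (0, 0).
  have [l l0 /conjX[y Py]] := ray_meets_boundary bX sX (xne0 _ t01).
  by exists (l, y).
pose l t := (ly t).1; pose y t := (ly t).2.
(* [1 / l t] is the gauge of [X] at [x t]. The functional [omega(., y t) / c t] supports [X] at
   [l t *: x t], and [m t] is its slope along [d], a subgradient of the gauge. *)
pose c t := omega (l t *: x t) (y t); pose m t := omega d (y t) / c t.
have l_gt0 t : 0 <= t <= 1 -> 0 < l t by move=> /Hly[].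
have P t : 0 <= t <= 1 -> conjugate_pair (l t *: x t) (y t) by move=> /Hly[].
have c_gt0 t : 0 <= t <= 1 -> 0 < c t by move=> /P[].
have cE s t : 0 <= s <= 1 -> omega (l t *: x t) (y s) = l t * (c s * ((l s)^-1 + (t - s) * m s)).
  move=> s01; rewrite omegaZl (xst s t) omegaDl omegaZl /m /c omegaZl; congr (_ * _).
  have ls := l_gt0 _ s01; have := c_gt0 _ s01; rewrite /c omegaZl => cs.
  have ws : 0 < omega (x s) (y s) by rewrite pmulr_rgt0 in cs.
  by field; rewrite !gt_eqF.
(* Subgradient inequality: the support functional at [s] is at most 1 at [l t *: x t]. *)
have slope s t : 0 <= s <= 1 -> 0 <= t <= 1 -> (l s)^-1 + (t - s) * m s <= (l t)^-1.
  move=> s01 t01; have [_ _ _ /(_ (l t *: x t)) + _] := P _ s01.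
  rewrite cE// -/(c s) => H.
  have cs := c_gt0 _ s01; have lt := l_gt0 _ t01.
  have {}H : l t * (c s * ((l s)^-1 + (t - s) * m s)) <= c s.
    by apply: H; case: (P _ t01).
  rewrite -(ler_pM2l cs) -(ler_pM2l lt); apply: (le_trans H).
  by rewrite mulrCA divff ?gt_eqF ?mulr1.
pose C := M * M *+ (n + n); pose K := C * (M / del).
have Hmod s t : 0 <= s <= t -> t <= 1 -> c s - c t <= K * ((m t - m s) * (t - s)).
  move=> /andP[s0 st] t1.
  have s01 : 0 <= s <= 1 by rewrite s0 (le_trans st).
  have t01 : 0 <= t <= 1 by rewrite t1 (le_trans s0).
  have cs := c_gt0 _ s01; have lt := l_gt0 _ t01.
  (* The other maximality: [y s] competes with [y t] against [l t *: x t], which bounds [c t]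
     below. *)
  have [Xlt _ _ _ /(_ (y s))] := P _ t01; have [Xls Xys _ _ _] := P _ s01.
  move=> /(_ Xys); rewrite cE// -/(c t) => Hc.
  have S1 := slope _ _ s01 t01; have S2 := slope _ _ t01 s01.
  have clK : c s * l t <= K.
    apply: ler_pM; rewrite ?(ltW cs) ?(ltW lt)//.
      apply: le_trans (ler_norm _) _; apply: omega_bounded; rewrite ?(ltW M0) ?HM//.
    rewrite ler_pdivlMr//; apply: le_trans (HM _ Xlt).
    by rewrite normrZ gtr0_norm// ler_pM2l// Hdel.
  have E1 : c s - c t <= c s * l t * ((l t)^-1 - (l s)^-1 - (t - s) * m s).
    have -> : c s * l t * ((l t)^-1 - (l s)^-1 - (t - s) * m s) =
      c s * (l t * (l t)^-1) - l t * (c s * ((l s)^-1 + (t - s) * m s)) by ring.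
    by rewrite divff ?gt_eqF// mulr1 lerB.
  apply: (le_trans E1); apply: (@le_trans _ _ (c s * l t * ((m t - m s) * (t - s)))).
    by rewrite ler_pM2l ?mulr_gt0//; lra.
  by apply: ler_wpM2r => //; lra.
have c01 := le_of_monotone_modulus Hmod.
have t0 : 0 <= (0 : R) <= 1 by rewrite lexx ler01.
have t1 : 0 <= (1 : R) <= 1 by rewrite ler01 lexx.
(* The pairs chosen at the endpoints may differ from the given ones, but have the same values. *)
move: c01 (P _ t0) (P _ t1) (l_gt0 _ t0) (l_gt0 _ t1); rewrite /c x0E x1E.
move=> c01 P0' P1' l0 l1.
by rewrite -(conjugate_pair_ray l0 P0' P0) -(conjugate_pair_ray l1 P1' P1).
Qed.

End ConjugatePairs.

(** * From billiard orbits to conjugate pairs and the polar *)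

Section OuterBilliards.
Variables (R : realType) (n : nat) (X : set (V R n)).
Hypotheses (bX : convex_body X) (sX : centrally_symmetric X).
Hypotheses (scX : strictly_convex X) (C2X : C2_boundary X).

(* [get] of an empty set is [0], so a nonzero reflection centre is a foot. *)
Lemma outer_billiard_foot (z x : V R n) :
  outer_billiard X z = 2 *: x - z -> x != 0 -> billiard_foot X z x.
Proof.
have two0 : (2 : R) != 0 by rewrite pnatr_eq0.
rewrite /outer_billiard => /addIr/(scalerI two0) <- g0.
apply: (getPex (P := [set x | billiard_foot X z x])).
apply: contrapT => N; case/eqP: g0; rewrite getPN; last first.
  by move=> y Hy; apply: N; exists y.
by apply/rowP => i; rewrite !mxE.
Qed.

(** With [y = x - z], the foot at [z] is [x] and the foot at [2 *: x - z] is [y]. The characteristic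
    directions there are [- y] and [x], so [omega(., y)] and [omega(x, .)] vanish on the tangent
    spaces at [x] and [y] respectively. *)
Lemma billiard_orbit_conjugate (z x : V R n) : boundary X x -> ~ X z ->
  iter 2 (outer_billiard X) z = - z ->
  x = 2^-1 *: (z + outer_billiard X z) -> exists y, conjugate_pair X x y.
Proof.
move=> Bx Xz /= T2 xE.
have Tz : outer_billiard X z = 2 *: x - z.
  by rewrite xE scalerA divff ?pnatr_eq0// scale1r addrC addKr.
have [_ [[_ ann_x] x_gt0]] := outer_billiard_foot Tz (boundary_neq0 bX sX Bx).
have xz0 : x - z != 0.
  by rewrite subr_eq0; apply: contra_not_neq Xz => <-; exact: boundary_sub.
have T2z : outer_billiard X (2 *: x - z) = 2 *: (x - z) - (2 *: x - z).
  rewrite -Tz T2 Tz scalerBr opprB.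
  have -> : 2 *: z = z + z by rewrite scaler_nat mulr2n.
  by rewrite addrC addrA subrK opprD addrA subrr add0r.
have [By [[_ ann_y] _]] := outer_billiard_foot T2z xz0.
exists (x - z); split => //; try exact: boundary_sub.
- apply: (support_of_tangent_annihilator bX sX scX C2X (f := fun v => omega v (x - z)) Bx) => //.
  + by move=> u v; rewrite omegaDl.
  + by move=> c v; rewrite omegaZl.
  + by move=> v /ann_x <-; rewrite omegaC -omegaNl opprB.
- apply: (support_of_tangent_annihilator bX sX scX C2X (f := omega x) By) => //.
  + exact: omegaDr.
  + by move=> c v; rewrite omegaZr.
  + move=> v /ann_y; have -> // : 2 *: x - z - (x - z) = x.
    by rewrite opprB addrA subrK scaler_nat mulr2n addrK.
Qed.

(** Both sides amount to [1 <= l], where [l *: w] is the boundary point on the ray of [w]. For the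
    converse the polar inequality is tested at [- y], with [y] conjugate to [l *: w]. *)
Lemma conjugate_pairs_scaled_polar (alpha : R) : 0 < alpha ->
  (forall x, boundary X x -> exists2 y, conjugate_pair X x y & omega x y = alpha) ->
  forall w, X w <-> (forall x, X x -> omega x w <= alpha).
Proof.
move=> a0 H w; have [->|w0] := eqVneq w 0.
  split=> [_ x _|_]; first by rewrite omega0r ltW.
  exact: interior_subset (convex_body_interior0 bX sX).
have [l l0 Bl] := ray_meets_boundary bX sX w0.
have [y [_ Xy _ _ supp] xy] := H _ Bl; split => [Xw x Xx|Hw].
  have l1 := boundary_ray_ge1 bX sX scX Xw l0 Bl.
  have := supp _ (sX Xx); rewrite xy omegaZl omegaNr -omegaC => H1.
  rewrite -(ler_pM2l l0); apply: (le_trans H1).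
  by rewrite ler_peMl ?(ltW a0).
have l1 : 1 <= l.
  have := Hw _ (sX Xy); rewrite omegaNl -omegaC.
  move: xy; rewrite omegaZl => xy H1.
  have w1 : 0 < omega w y by rewrite -(pmulr_rgt0 _ l0) xy.
  by rewrite -(ler_pM2r w1) xy mul1r.
have := bX.2.2 _ _ l^-1 (boundary_sub bX Bl) (interior_subset (convex_body_interior0 bX sX)).
rewrite scaler0 addr0 scalerK ?gt_eqF//; apply.
by rewrite invr_ge0 (ltW l0) invf_le1.
Qed.

End OuterBilliards.

Theorem theorem3p2 (R : realType) (n : nat) (X : set 'rV[R]_(n + n)) :
  convex_body X -> centrally_symmetric X -> strictly_convex X ->
  C2_boundary X ->
  (forall x, boundary X x ->
     exists z, ~ X z /\
       iter 4 (outer_billiard X) z = z /\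
       iter 2 (outer_billiard X) z = - z /\
       x = 2^-1 *: (z + outer_billiard X z)) ->
  exists alpha : R, 0 < alpha /\
    X = scale_set alpha (symp_polar X) /\
    scale_set (Num.sqrt alpha)^-1 X = symp_polar (scale_set (Num.sqrt alpha)^-1 X).
Proof.
move=> bX sX scX C2X orbits.
have conjX x : boundary X x -> exists y, conjugate_pair X x y.
  move=> Bx; have [z [Xz [_ [T2 xE]]]] := orbits x Bx.
  exact: billiard_orbit_conjugate Bx Xz T2 xE.
have [alpha a0 Ha] : exists2 alpha, 0 < alpha & forall x, boundary X x ->
    exists2 y, conjugate_pair X x y & omega x y = alpha.
  (* For [n = 0] the boundary is empty and any positive constant serves. *)
  have [[p Bp]|noB] := pselect (exists p, boundary X p); last first.
    by exists 1 => // x Bx; case: noB; exists x.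
  have [q Pq] := conjX p Bp; exists (omega p q); first by case: Pq.
  move=> x Bx; have [y Py] := conjX x Bx; exists y => //.
  by apply/eqP; rewrite eq_le !(conjugate_pair_le bX sX conjX).
have XE := conjugate_pairs_scaled_polar bX sX scX a0 Ha.
have r0 : 0 < Num.sqrt alpha by rewrite sqrtr_gt0.
exists alpha; split => //; split; apply/seteqP; split => w.
- move=> /XE Hw; exists (alpha^-1 *: w); last by rewrite scalerKV ?gt_eqF.
  by move=> x /Hw; rewrite omegaZr mulrC ler_pdivrMr// mul1r.
- move=> [v Hv <-]; apply/XE => x /Hv.
  by rewrite omegaZr ger_pMr.
(* Scaling both arguments by the inverse of [Num.sqrt alpha] divides [omega] by [alpha]. *)
- move=> [v /XE Hv <-] _ [x /Hv Hx <-].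
  rewrite omegaZl omegaZr mulrA -invfM -expr2 sqr_sqrtr ?(ltW a0)//.
  by rewrite mulrC ler_pdivrMr// mul1r.
- move=> Hw; exists (Num.sqrt alpha *: w); last by rewrite scalerK ?gt_eqF.
  apply/XE => x Xx; rewrite omegaZr -{2}(sqr_sqrtr (ltW a0)) expr2 ler_pM2l//.
  have := Hw _ (ex_intro2 _ _ x Xx erefl); rewrite omegaZl mulrC.
  by rewrite ler_pdivrMr// mul1r.
Qed.
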